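(* Consider two locally-balanced Markov jump processes with the same target distribution $\pi$ and the same kernel $\gamma$, and with non-decreasing balancing functions $g_1$ and $g_2$ respectively. Let $L_1$ and $L_2$ be the generators of the two processes. Assume that $g_1(s)\ge\omega\,g_2(s)$ for all $s\ge0$ and some $\omega>0$. Then $\gamma_{L_1}\ge\omega\cdot\gamma_{L_2}$.
   Context: Let $E$ be a Polish space with Borel $\sigma$-algebra $\mathcal{E}$, $\pi$ a probability measure on $(E,\mathcal{E})$, and $\gamma:E\times\mathcal{E}\to[0,1]$ a Markov kernel. Write $[\pi\otimes\gamma](dx,dy)=\pi(dx)\gamma(x,dy)$. The function $t:E\times E\to[0,\infty)$ is a version of the Radon--Nikodym derivative $t(x,y)=\frac{\pi(dy)\gamma(y,dx)}{\pi(dx)\gamma(x,dy)}$ such that, for some measurable $R\subset E\times E$ with $[\pi\otimes\gamma](R)=1$, one has $0<t(x,y)<\infty$ and $t(y,x)=1/t(x,y)$ for $(x,y)\in R$, and $t(x,y)=0$ for $(x,y)\notin R$. A balancing function is a (Borel) function $g:[0,\infty)\to[0,\infty)$ with $g(1)=1$, $g(0)=0$, $g(s)>0$ for $s>0$, and $g(s)=s\,g(1/s)$ for all $s>0$. The (weak) generator of the locally-balanced Markov jump process with balancing function $g$, kernel $\gamma$ and target $\pi$ (the pure jump process with jump kernel $g(t(x,y))\gamma(x,dy)$) acts on bounded measurable $f$ by $Lf(x)=\int_E g(t(x,y))(f(y)-f(x))\,\gamma(x,dy)$. Its Dirichlet form is $\mathcal{E}(L,f)=\langle f,-Lf\rangle_\pi=-\int_E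 f\,Lf\,d\pi$ and its spectral gap is $\gamma_L=\inf_{f\in\mathcal{B}(E)}\mathcal{E}(L,f)/\mathrm{Var}_\pi(f)$, with $\mathcal{B}(E)$ the bounded measurable functions (infimum over $f$ with $\mathrm{Var}_\pi(f)>0$). *)

(* Defs.v *)
From HB Require Import structures.
From mathcomp Require Import all_boot all_order all_algebra.
From mathcomp Require Import all_classical all_reals all_analysis.

Set Implicit Arguments.
Unset Strict Implicit.
Unset Printing Implicit Defensive.

Import Order.TTheory GRing.Theory Num.Theory.
Import numFieldNormedType.Exports.

Local Open Scope classical_set_scope.
Local Open Scope ring_scope.

(* Nonnegativity of [d] follows from the three metric axioms. *)
Definition polish (R : realType) (T : topologicalType) : Prop :=
  (exists2 D : set T, countable D & dense D) /\
  exists d : T -> T -> R,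
    [/\ forall x y, d x y = 0 <-> x = y,
        forall x y, d x y = d y x,
        forall x y z, d x z <= d x y + d y z,
        forall x (A : set T),
          nbhs x A <-> exists2 e : R, 0 < e & [set y | d x y < e] `<=` A &
        forall u : nat -> T,
          (forall e : R, 0 < e -> exists N, forall m n,
             (N <= m)%N -> (N <= n)%N -> d (u m) (u n) < e) ->
          exists l : T, u @ \oo --> l].

Notation borel T := (g_sigma_algebraType (@open T)).

(* The measure pi(dx) gamma(x, dy) on the product space. *)
Section kernel_joint.
Local Open Scope ereal_scope.
Context d (T : measurableType d) (R : realType).
Variables (pi : probability T R) (gamma : R.-pker T ~> T).

Definition kjoint (A : set (T * T)) : \bar R :=
  \int[pi]_x gamma x (xsection A x).

Let kjoint0 : kjoint set0 = 0.
Proof.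
by apply: integral0_eq => x _; rewrite xsection0 measure0.
Qed.

Let kjoint_ge0 A : 0 <= kjoint A.
Proof. by apply: integral_ge0 => x _; exact: measure_ge0. Qed.

Let kjoint_sigma_additive : semi_sigma_additive kjoint.
Proof.
move=> F mF tF mUF.
have -> : kjoint (\bigcup_n F n) = \sum_(n <oo) kjoint (F n).
  rewrite /kjoint -integral_nneseries//; last first.
    by move=> n; apply: measurable_fun_xsection_finite_kernel; rewrite inE.
  apply: eq_integral => x _; rewrite xsection_bigcup.
  apply/esym/cvg_lim => //; apply: measure_semi_sigma_additive.
  - by move=> n; exact: measurable_xsection.
  - exact: trivIset_xsection.
  - by apply: bigcup_measurable => n _; exact: measurable_xsection.
exact: is_cvg_ereal_nneg_natsum.
Qed.

HB.instance Definition _ := isMeasure.Build _ _ _ kjoint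
  kjoint0 kjoint_ge0 kjoint_sigma_additive.

End kernel_joint.

Section locally_balanced.
Context d (T : measurableType d) (R : realType).
Variables (pi : probability T R) (gamma : R.-pker T ~> T).

(* The pushforward of pi(dx) gamma(x, dy) by (x, y) |-> (y, x) is the measure
   written pi(dy) gamma(y, dx). *)
Definition balancing_ratio (t : T * T -> R) : Prop :=
  [/\ measurable_fun setT t,
      forall z, 0 <= t z,
      forall A : set (T * T), measurable A ->
        pushforward (kjoint pi gamma) (fun z => (z.2, z.1)) A =
        (\int[kjoint pi gamma]_(z in A) (t z)%:E)%E &
      exists D : set (T * T),
        [/\ measurable D,
            kjoint pi gamma D = 1%E,
            forall x y, D (x, y) -> 0 < t (x, y) /\ t (y, x) = (t (x, y))^-1 &
            forall x y, ~ D (x, y) -> t (x, y) = 0]].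

(* Functions on [0, +oo) are represented by functions on R of which only the
   values on [0, +oo) matter. *)
Definition balancing_function (g : R -> R) : Prop :=
  [/\ measurable_fun (`[0, +oo[ : set R) g,
      forall s, 0 <= s -> 0 <= g s,
      g 1 = 1 /\ g 0 = 0,
      forall s, 0 < s -> 0 < g s &
      forall s, 0 < s -> g s = s * g s^-1].

Local Open Scope ereal_scope.

(* Extended-real valued, as g (t (x, .)) need not be gamma x-integrable at every
   x; when g is non-decreasing it is so for pi-almost every x. *)
Definition lb_generator (t : T * T -> R) (g : R -> R) (f : T -> R) (x : T) :
    \bar R :=
  \int[gamma x]_y (g (t (x, y)) * (f y - f x))%:E.

Definition dirichlet_form (L : (T -> R) -> T -> \bar R) (f : T -> R) : \bar R :=
  - \int[pi]_x ((f x)%:E * L f x).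

(* Equal to +oo when every bounded measurable function has zero variance. *)
Definition spectral_gap (L : (T -> R) -> T -> \bar R) : \bar R :=
  ereal_inf [set dirichlet_form L f / 'V_pi[f] | f in
    [set f : T -> R | [/\ measurable_fun setT f, bounded_fun f & 0 < 'V_pi[f]]]].

End locally_balanced.

(* Main.v *)
Require Import Defs.
From HB Require Import structures.
From mathcomp Require Import all_boot all_order all_algebra.
From mathcomp Require Import all_classical all_reals all_analysis.
From mathcomp Require Import measurable_realfun.
From mathcomp Require Import ring lra.

Import Order.TTheory GRing.Theory Num.Theory.
Import numFieldNormedType.Exports.

Local Open Scope classical_set_scope.
Local Open Scope ring_scope.

(** Write [nu] for the joint law [pi(dx) gamma(x, dy)]. The result is a
    comparison of Dirichlet forms: for every bounded measurable [f],
<<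
      E(L, f) = 1/2 \int g(t(x, y)) (f(y) - f(x))^2 nu(dx, dy),
>>
    so that [g1 >= omega g2] gives [E(L1, f) >= omega E(L2, f)]; dividing by the
    variance and taking infima compares the spectral gaps.

    The formula for [E(L, f)] expresses reversibility. Since [t] is the density
    of the swapped law with respect to [nu], integrating [F(y, x)] against [nu]
    amounts to integrating [F t] ([ge0_integral_swap]). The balancing identity
    [g(s) = s g(1/s)] reads [g(t(y, x)) t(x, y) = g(t(x, y))] ([rate_swap]), and
    the two together make the measure [g(t) nu] symmetric
    ([ge0_integral_rate_sym]). Hence [f(x)^2] and [f(y)^2] have the same integral
    against it, and expanding the square turns
    [- \int f(x) (f(y) - f(x)) g(t) nu] into the formula.

    Every integral involved is finite because a non-decreasing balancing function
    satisfies [g(s) <= 1 + s] and [t] has integral 1 under [nu]; this is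
    [integrable_rate]. It also justifies Fubini's theorem for [nu]
    ([integral_kjoint]), which turns the iterated integral of the Dirichlet form
    into an integral against [nu].

    Both the iterated-integral formula for [nu] and the change of variables by
    [t] are known on indicators by definition. They extend to nonnegative
    functions by the same approximation argument, carried out once for abstract
    functionals in [ge0_functional_integral]. *)

(** * Functionals that are integrals *)

Section integral_functional.
Import HBNNSimple.
Local Open Scope ereal_scope.
Context {d} {X : measurableType d} {R : realType}.
Variables (mu : {measure set X -> \bar R}) (Phi : (X -> \bar R) -> \bar R).

Hypothesis Phi_indic :
  forall A, measurable A -> Phi (fun z => (\1_A z)%:E) = mu A.
Hypothesis PhiD : forall F G : X -> \bar R,
  measurable_fun setT F -> measurable_fun setT G ->
  (forall z, 0 <= F z) -> (forall z, 0 <= G z) ->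
  Phi (fun z => F z + G z) = Phi F + Phi G.
Hypothesis PhiZ : forall (k : R) (F : X -> \bar R), (0 <= k)%R ->
  measurable_fun setT F -> (forall z, 0 <= F z) ->
  Phi (fun z => k%:E * F z) = k%:E * Phi F.
Hypothesis Phi_lim : forall F : (X -> \bar R)^nat,
  (forall n, measurable_fun setT (F n)) -> (forall n z, 0 <= F n z) ->
  (forall z, nondecreasing_seq (F ^~ z)) ->
  Phi (fun z => limn (F ^~ z)) = limn (fun n => Phi (F n)).

Lemma functional_sum (F : nat -> X -> \bar R) (n : nat) :
  (forall i, measurable_fun setT (F i)) -> (forall i z, 0 <= F i z) ->
  Phi (fun z => \sum_(i < n) F i z) = \sum_(i < n) Phi (F i).
Proof.
move=> mF F0; elim: n => [|n IHn].
  rewrite big_ord0; transitivity (mu set0); last exact: measure0.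
  rewrite -(Phi_indic _ measurable0).
  by congr (Phi _); apply/funext => z; rewrite big_ord0 indic0.
under [X in Phi X]eq_fun do rewrite big_ord_recr.
rewrite big_ord_recr/= PhiD//; first by rewrite IHn.
- exact: emeasurable_sum.
- by move=> z; exact: sume_ge0.
Qed.

Lemma functional_nnsfun (f : {nnsfun X >-> R}) :
  Phi (fun z => (f z)%:E) = \int[mu]_z (f z)%:E.
Proof.
pose s : seq R := finmap.enum_fset (fset_set (range f)).
(* The values of [f] are nonnegative, so the truncation changes nothing on
   them; it makes the coefficients nonnegative for every index. *)
pose c i : R := Num.max (s`_i)%R 0%R.
pose A i : set X := f @^-1` [set (s`_i)%R].
have fE z : (f z)%:E = \sum_(i < size s) (c i)%:E * (\1_(A i) z)%:E.
  rewrite fimfunEord -sumEFin; apply: eq_bigr => i _; rewrite EFinM.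
  congr (_%:E * _); rewrite /c max_l//.
  have : (s`_i)%R \in s by exact: mem_nth.
  by rewrite (in_fset_set (fimfunP f)) inE => -[x _ <-].
have mA i : measurable (A i) by exact: measurable_funPTI.
have c0 i : (0 <= c i)%R by rewrite /c le_max lexx orbT.
have m1 i : measurable_fun setT (fun z => (\1_(A i) z)%:E : \bar R).
  exact/measurable_EFinP.
have p1 i z : 0 <= (\1_(A i) z)%:E :> \bar R by rewrite lee_fin.
rewrite (funext fE).
rewrite (functional_sum (fun i z => (c i)%:E * (\1_(A i) z)%:E)); last 2 first.
- by move=> i; exact: measurable_funeM.
- by move=> i z; rewrite mule_ge0// lee_fin.
rewrite ge0_integral_sum//; last 2 first.
- by move=> i; exact: measurable_funeM.
- by move=> i z _; rewrite mule_ge0// lee_fin.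
apply: eq_bigr => i _; rewrite PhiZ// Phi_indic// ge0_integralZl ?lee_fin//.
by rewrite integral_indic// setIT.
Qed.

(** The uniqueness half of the standard machine: indicators determine [Phi] on
    simple functions by linearity, and these determine it on all nonnegative
    measurable functions by monotone limits. *)
Lemma ge0_functional_integral (F : X -> \bar R) :
  measurable_fun setT F -> (forall z, 0 <= F z) -> Phi F = \int[mu]_z F z.
Proof.
move=> mF F0; pose h := nnsfun_approx measurableT mF.
have hF z : F z = limn (fun n => (h n z)%:E).
  by apply/esym/cvg_lim => //; exact: cvg_nnsfun_approx.
have mh n : measurable_fun setT (fun z => (h n z)%:E) by exact/measurable_EFinP.
have h0 n z : 0 <= (h n z)%:E by rewrite lee_fin.
have ndh z : nondecreasing_seq (fun n => (h n z)%:E).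
  by move=> m n mn; rewrite lee_fin; exact/lefP/nd_nnsfun_approx.
rewrite (funext hF) (Phi_lim (fun n z => (h n z)%:E))//.
rewrite monotone_convergence//.
by congr (limn _); apply/funext => n; exact: functional_nnsfun.
Qed.

End integral_functional.

(** * Fubini's theorem for the joint law *)

Section kjoint_integral.
Local Open Scope ereal_scope.
Context {d} {T : measurableType d} {R : realType}.
Variables (pi : probability T R) (gamma : R.-pker T ~> T).
Local Notation nu := (kjoint pi gamma).

Lemma kjointT : nu setT = 1.
Proof.
rewrite /kjoint -[RHS](@probability_setT _ _ _ pi) -[RHS]mul1e -integral_cst//.
apply: eq_integral => x _; rewrite -[RHS](@prob_kernel _ _ _ _ _ gamma x).
by congr (gamma x _); apply/seteqP; split => y //= _; rewrite /xsection/= inE.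
Qed.

(** Tonelli's theorem: on an indicator this is the definition of [nu]. *)
Lemma ge0_integral_kjoint (F : T * T -> \bar R) :
  measurable_fun setT F -> (forall z, 0 <= F z) ->
  \int[pi]_x \int[gamma x]_y F (x, y) = \int[nu]_z F z.
Proof.
have mF1 (G : T * T -> \bar R) x : measurable_fun setT G ->
    measurable_fun setT (fun y => G (x, y)).
  by move=> mG; exact: measurableT_comp.
have mF2 (G : T * T -> \bar R) :
    measurable_fun setT G -> (forall z, 0 <= G z) ->
    measurable_fun setT (fun x => \int[gamma x]_y G (x, y)).
  by move=> mG G0; exact: (measurable_fun_integral_finite_kernel _ gamma).
apply: (ge0_functional_integral nu
  (fun F => \int[pi]_x \int[gamma x]_y F (x, y))) => [A mA|G H mG mH G0 H0|
  k G k0 mG G0|G mG G0 ndG].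
- apply: eq_integral => x _ /=; rewrite -[xsection A x]setIT -integral_indic//.
    by apply: eq_integral => y _; rewrite !indicE mem_xsection.
  exact: measurable_xsection.
- rewrite -ge0_integralD//; last 4 first.
  + by move=> x _; exact: integral_ge0.
  + exact: mF2.
  + by move=> x _; exact: integral_ge0.
  + exact: mF2.
  by apply: eq_integral => x _; rewrite ge0_integralD//; exact: mF1.
- rewrite -ge0_integralZl//; last 2 first.
  + exact: mF2.
  + by move=> x _; exact: integral_ge0.
  by apply: eq_integral => x _; rewrite ge0_integralZl//; exact: mF1.
- rewrite -monotone_convergence//; last 3 first.
  + by move=> n; exact: mF2.
  + by move=> n x _; exact: integral_ge0.
  + move=> x _ m n mn; apply: ge0_le_integral => //; try exact: mF1.
    by move=> y _; exact: ndG.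
  apply: eq_integral => x _; rewrite monotone_convergence//.
  + by move=> n; exact: mF1.
Qed.

Lemma integrable_integral_section (F : T * T -> \bar R) :
  nu.-integrable setT F -> (forall z, 0 <= F z) ->
  pi.-integrable setT (fun x => \int[gamma x]_y F (x, y)).
Proof.
move=> intF F0; have mF := measurable_int _ intF; apply/integrableP; split.
  exact: (measurable_fun_integral_finite_kernel F gamma).
rewrite (eq_integral (fun x => \int[gamma x]_y F (x, y))); last first.
  by move=> x _; rewrite gee0_abs// integral_ge0.
by rewrite ge0_integral_kjoint// integrable_lty.
Qed.

Section integrable.
Variables (F : T * T -> \bar R).
Hypothesis intF : nu.-integrable setT F.

(** The integral of [`|F|] over the section at [x] is [pi]-integrable in [x],
    hence finite for almost every [x]. *)
Lemma ae_integrable_section :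
  {ae pi, forall x, (gamma x).-integrable setT (fun y => F (x, y))}.
Proof.
have mF := measurable_int _ intF.
have /(integrable_ae measurableT) := integrable_integral_section _
  (integrable_abse intF) (fun z => abse_ge0 (F z)).
apply: filterS => x /(_ I) xfin.
apply/integrableP; split; first exact: measurableT_comp.
by rewrite ltey_eq xfin.
Qed.

Let integral_sectionE x : \int[gamma x]_y F (x, y) =
  \int[gamma x]_y F^\+ (x, y) - \int[gamma x]_y F^\- (x, y).
Proof.
rewrite integralE; congr (_ - _); apply: eq_integral => y _.
- by rewrite !funeposE.
- by rewrite !funenegE.
Qed.

Lemma measurable_integral_section :
  measurable_fun setT (fun x => \int[gamma x]_y F (x, y)).
Proof.
have mF := measurable_int _ intF.
rewrite (funext integral_sectionE); apply: emeasurable_funB.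
- apply: (measurable_fun_integral_finite_kernel F^\+ gamma) => //.
  exact: measurable_funepos.
- apply: (measurable_fun_integral_finite_kernel F^\- gamma) => //.
  exact: measurable_funeneg.
Qed.

(** The inner integral is by definition the difference of the integrals of the
    positive and negative parts of [F], even where that difference is
    [+oo - oo], so that Tonelli's theorem applies to the two parts without
    discarding a null set. *)
Lemma integral_kjoint :
  \int[pi]_x \int[gamma x]_y F (x, y) = \int[nu]_z F z.
Proof.
have mF := measurable_int _ intF.
have ip := integrable_funepos measurableT intF.
have im := integrable_funeneg measurableT intF.
rewrite [RHS]integralE -!ge0_integral_kjoint//; last 2 first.
- exact: measurable_funeneg.
- exact: measurable_funepos.
rewrite -integralB//; [|exact: integrable_integral_section..].
by apply: eq_integral => x _; rewrite integral_sectionE.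
Qed.

End integrable.
End kjoint_integral.

(** * Reversibility of the jump rate *)

Section balancing_function_bound.
Context {R : realType} (g : R -> R).
Hypotheses (g_bal : balancing_function g)
  (g_nd : forall s u : R, 0 <= s -> s <= u -> g s <= g u).

(** For [s <= 1] monotonicity gives [g s <= g 1 = 1]; for [s > 1] it gives
    [g (1 / s) <= 1], that is [g s <= s]. *)
Lemma balancing_function_le1D (s : R) : 0 <= s -> g s <= 1 + s.
Proof.
move=> s0; have [_ _ [g1 _] _ gV] := g_bal.
have [s1|s1] := leP s 1.
  by rewrite (le_trans (g_nd s 1 s0 s1))// g1 lerDl.
have sp : 0 < s by rewrite (lt_trans ltr01).
rewrite gV// (@le_trans _ _ s)//; last by rewrite lerDr.
by rewrite ler_piMr// -[leRHS]g1 g_nd ?invr_ge0// invf_le1// ltW.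
Qed.

End balancing_function_bound.

Section reversibility.
Local Open Scope ereal_scope.
Context {d} {T : measurableType d} {R : realType}.
Variables (pi : probability T R) (gamma : R.-pker T ~> T) (t : T * T -> R).
Hypothesis t_ratio : balancing_ratio pi gamma t.
Local Notation nu := (kjoint pi gamma).
Let swap (z : T * T) := (z.2, z.1).

Let measurable_swap : measurable_fun setT swap.
Proof. exact: measurable_fun_pair. Qed.

(** The density property of [t], extended from sets to functions. *)
Lemma ge0_integral_swap (F : T * T -> \bar R) :
  measurable_fun setT F -> (forall z, 0 <= F z) ->
  \int[nu]_z F (z.2, z.1) = \int[nu]_z (F z * (t z)%:E).
Proof.
move=> mF F0; have [mt t0 tE _] := t_ratio.
have mFt (G : T * T -> \bar R) : measurable_fun setT G ->
    measurable_fun setT (fun z => G z * (t z)%:E).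
  by move=> mG; apply: emeasurable_funM => //; exact/measurable_EFinP.
have Ft0 (G : T * T -> \bar R) z : (forall z, 0 <= G z) -> 0 <= G z * (t z)%:E.
  by move=> G0; rewrite mule_ge0// lee_fin.
transitivity (\int[pushforward nu swap]_z F z).
  by rewrite ge0_integral_pushforward.
apply/esym; move: F mF F0; apply: (ge0_functional_integral _
  (fun F => \int[nu]_z (F z * (t z)%:E))) => [A mA|G H mG mH G0 H0|
  k G k0 mG G0|G mG G0 ndG].
- rewrite [RHS]tE// [RHS]integral_mkcond; apply: eq_integral => z _.
  by rewrite epatch_indic muleC.
- rewrite -ge0_integralD//; last 4 first.
  + by move=> z _; exact: Ft0.
  + exact: mFt.
  + by move=> z _; exact: Ft0.
  + exact: mFt.
  by apply: eq_integral => z _; rewrite ge0_muleDl.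
- rewrite -ge0_integralZl//; [|exact: mFt|by move=> z _; exact: Ft0].
  by apply: eq_integral => z _; rewrite muleA.
- rewrite -monotone_convergence//; last 3 first.
  + by move=> n; exact: mFt.
  + by move=> n z _; exact: Ft0.
  + by move=> z _ m n mn; rewrite lee_wpmul2r ?lee_fin//; exact: ndG.
  apply: eq_integral => z _; apply/esym/cvg_lim => //.
  by apply: cvgeZr => //; apply: ereal_nondecreasing_is_cvgn; exact: ndG.
Qed.

(** The integral of [t] is the total mass of the swapped law. *)
Lemma integrable_ratio : nu.-integrable setT (fun z => (t z)%:E).
Proof.
have [mt t0 tE _] := t_ratio.
apply/integrableP; split; first exact/measurable_EFinP.
rewrite (eq_integral (fun z => (t z)%:E)); last first.
  by move=> z _; rewrite gee0_abs// lee_fin.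
by rewrite -tE// /pushforward preimage_setT kjointT ltry.
Qed.

Section rate.
Variable g : R -> R.
Hypotheses (g_bal : balancing_function g)
  (g_nd : forall s u : R, (0 <= s -> s <= u -> g s <= g u)%R).

Let w z := g (t z).

Lemma rate_ge0 z : (0 <= w z)%R.
Proof. by have [_ t0 _ _] := t_ratio; have [_ + _ _ _] := g_bal; apply. Qed.

Lemma measurable_rate : measurable_fun setT w.
Proof.
have [mt t0 _ _] := t_ratio; have [mg _ _ _ _] := g_bal.
apply: (measurable_comp _ _ mg mt) => //.
by move=> _ [z _ <-]; rewrite /= in_itv/= t0.
Qed.

Lemma integrable_rate : nu.-integrable setT (fun z => (w z)%:E).
Proof.
have [mt t0 _ _] := t_ratio.
apply: (@le_integrable _ _ _ nu _ _ _ (fun z => 1 + (t z)%:E)) => //.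
- by apply/measurable_EFinP; exact: measurable_rate.
- move=> z _; rewrite !gee0_abs ?adde_ge0// ?lee_fin ?rate_ge0//.
  exact: balancing_function_le1D.
- apply: (integrableD measurableT _ integrable_ratio) => //.
  apply/integrableP; split; first exact: measurable_cst.
  rewrite (eq_integral (cst 1)) => [|z _]; last by rewrite gee0_abs.
  by rewrite integral_cst// mul1e [X in X < _]kjointT ltry.
Qed.

(** Detailed balance. It holds at every point, since both sides vanish where [t]
    is zero. *)
Lemma rate_swap z : (w (swap z) * t z = w z)%R.
Proof.
case: z => x y; have [_ t0 _ [D [_ _ Din Dout]]] := t_ratio.
have [_ _ [_ g0] _ gV] := g_bal; rewrite /w /swap/=.
have [/Din[tp ->]|/Dout ->] := pselect (D (x, y)); last by rewrite mulr0 g0.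
by rewrite mulrC -gV.
Qed.

(** Changing variables in [F(x, y) g(t(y, x))] produces a factor [t(x, y)], which
    detailed balance absorbs into the rate. *)
Lemma ge0_integral_rate_sym (F : T * T -> R) :
  measurable_fun setT F -> (forall z, 0 <= F z)%R ->
  \int[nu]_z (F (z.2, z.1) * w z)%:E = \int[nu]_z (F z * w z)%:E.
Proof.
move=> mF F0.
transitivity (\int[nu]_z (F z * w (swap z) * t z)%:E); last first.
  by apply: eq_integral => -[x y] _; rewrite -mulrA rate_swap.
have mK : measurable_fun setT (fun z => (F z * w (swap z))%:E).
  apply/measurable_EFinP/measurable_funM => //.
  exact: measurableT_comp measurable_rate measurable_swap.
under [RHS]eq_integral do rewrite EFinM.
rewrite -(ge0_integral_swap _ mK); first by apply: eq_integral => -[].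
by move=> z; rewrite lee_fin mulr_ge0// rate_ge0.
Qed.

Lemma integrable_bounded_rate (h : T * T -> R) :
  measurable_fun setT h -> (exists M : R, forall z, `|h z| <= M)%R ->
  nu.-integrable setT (fun z => (h z * w z)%:E).
Proof.
move=> mh [M hM].
apply: (le_integrable measurableT _ _
  (integrableZl measurableT M integrable_rate)).
- by apply/measurable_EFinP/measurable_funM => //; exact: measurable_rate.
- move=> z _; rewrite -EFinM !abse_EFin lee_fin !normrM ler_wpM2r//.
  by rewrite (le_trans (hM z))// ler_norm.
Qed.

(** * The Dirichlet form *)

Section dirichlet.
Variable f : T -> R.
Hypotheses (mf : measurable_fun setT f) (bf : bounded_fun f).

Let mf1 : measurable_fun setT (fun z : T * T => f z.1).
Proof. exact: measurableT_comp. Qed.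

Let mf2 : measurable_fun setT (fun z : T * T => f z.2).
Proof. exact: measurableT_comp. Qed.

Let bnd : exists M : R, (0 <= M)%R /\ forall x, (`|f x| <= M)%R.
Proof.
have [M [_ fM]] := bf; exists (`|M| + 1)%R; split; first by rewrite addr_ge0.
by move=> x; apply: fM => //; rewrite (le_lt_trans (ler_norm _))// ltrDl.
Qed.

Let intM (u v : T * T -> T) :
  measurable_fun setT (f \o u) -> measurable_fun setT (f \o v) ->
  nu.-integrable setT (fun z => (f (u z) * f (v z) * w z)%:E).
Proof.
move=> mu mv; apply: integrable_bounded_rate; first exact: measurable_funM.
have [M [M0 fM]] := bnd; exists (M * M)%R => z.
by rewrite normrM ler_pM.
Qed.

Let I11 := intM _ _ mf1 mf1.
Let I22 := intM _ _ mf2 mf2.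
Let I12 := intM _ _ mf1 mf2.

(** The factor [f x] enters the inner integral only where the rate is integrable,
    that is for almost every [x]; elsewhere a negative [f x] could change the
    value of an integral of the form [+oo - oo]. *)
Lemma integral_generator :
  \int[pi]_x ((f x)%:E * lb_generator gamma t g f x) =
  \int[nu]_z (f z.1 * (w z * (f z.2 - f z.1)))%:E.
Proof.
have [M [M0 fM]] := bnd.
have iG : nu.-integrable setT (fun z => ((f z.2 - f z.1) * w z)%:E).
  apply: integrable_bounded_rate; first exact: measurable_funB.
  exists (M + M)%R => z.
  by rewrite (le_trans (ler_normB _ _))// lerD.
have iH : nu.-integrable setT (fun z => (f z.1 * (w z * (f z.2 - f z.1)))%:E).
  rewrite (_ : (fun z => _) = (fun z => (f z.1 * f z.2 * w z)%:E) \-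
    (fun z => (f z.1 * f z.1 * w z)%:E)); first exact: integrableB.
  by apply/funext => z/=; rewrite -EFinB; congr _%:E; ring.
have LE : lb_generator gamma t g f =
    fun x => \int[gamma x]_y (fun z => ((f z.2 - f z.1) * w z)%:E) (x, y).
  by apply/funext => x; apply: eq_integral => y _; rewrite mulrC.
rewrite -integral_kjoint//; apply: ae_eq_integral => //.
- apply: emeasurable_funM; first exact/measurable_EFinP.
  by rewrite LE; exact: measurable_integral_section iG.
- exact: measurable_integral_section iH.
have := ae_integrable_section pi gamma _ iG; apply: filterS => x iGx _.
rewrite LE -integralZl//; apply: eq_integral => y _/=.
by rewrite -EFinM [(w _ * _)%R]mulrC.
Qed.

Lemma dirichlet_formE :
  dirichlet_form pi (lb_generator gamma t g) f =
  (2^-1)%:E * \int[nu]_z (w z * (f z.2 - f z.1) ^+ 2)%:E.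
Proof.
(* Only the nonnegative function [f^2] has to be swapped, the cross term
   [f(x) f(y)] being symmetric already. *)
have S : \int[nu]_z (f z.2 * f z.2 * w z)%:E =
    \int[nu]_z (f z.1 * f z.1 * w z)%:E.
  apply: (ge0_integral_rate_sym (fun z => f z.1 * f z.1)%R).
    exact: measurable_funM.
  by move=> z; rewrite -expr2 sqr_ge0.
rewrite /dirichlet_form integral_generator.
rewrite (eq_integral (fun z => (f z.1 * f z.2 * w z)%:E -
  (f z.1 * f z.1 * w z)%:E)); last first.
  by move=> z _; rewrite -EFinB; congr _%:E; ring.
rewrite [in RHS](eq_integral (fun z => ((f z.1 * f z.1 * w z)%:E +
  (f z.2 * f z.2 * w z)%:E) - 2%:E * (f z.1 * f z.2 * w z)%:E)); last first.
  by move=> z _; rewrite -EFinM -EFinD; congr _%:E; ring.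
rewrite integralB//.
rewrite (integralB _ (integrableD _ I11 I22) (integrableZl _ _ I12))//.
rewrite (integralD _ I11 I22)// integralZl// S.
have /fineK <- := integrable_fin_num measurableT I11.
have /fineK <- := integrable_fin_num measurableT I12.
set a := fine _; set b := fine _.
have ab : (- (a - b) = 2^-1 * ((b + b) - 2 * a))%R by lra.
exact: (congr1 EFin ab).
Qed.

End dirichlet.
End rate.

Lemma dirichlet_form_le (g1 g2 : R -> R) (omega : R) (f : T -> R) :
  balancing_function g1 -> balancing_function g2 ->
  (forall s u : R, (0 <= s -> s <= u -> g1 s <= g1 u)%R) ->
  (forall s u : R, (0 <= s -> s <= u -> g2 s <= g2 u)%R) ->
  (0 <= omega)%R -> (forall s : R, (0 <= s -> omega * g2 s <= g1 s)%R) ->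
  measurable_fun setT f -> bounded_fun f ->
  omega%:E * dirichlet_form pi (lb_generator gamma t g2) f
    <= dirichlet_form pi (lb_generator gamma t g1) f.
Proof.
move=> b1 b2 nd1 nd2 om0 g12 mf bf; have [_ t0 _ _] := t_ratio.
have msq g : balancing_function g ->
    measurable_fun setT (fun z => (g (t z) * (f z.2 - f z.1) ^+ 2)%:E).
  move=> bg; apply/measurable_EFinP/measurable_funM.
    exact: measurable_rate.
  by apply/measurable_funX/measurable_funB; exact: measurableT_comp.
have sq0 g z : balancing_function g ->
    0 <= (g (t z) * (f z.2 - f z.1) ^+ 2)%:E.
  by move=> bg; rewrite lee_fin mulr_ge0 ?sqr_ge0// rate_ge0.
rewrite !dirichlet_formE// muleCA lee_wpmul2l ?lee_fin ?invr_ge0//.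
rewrite -ge0_integralZl ?lee_fin//; last 2 first.
- exact: msq.
- by move=> z _; exact: sq0.
apply: ge0_le_integral => //.
- by move=> z _; rewrite mule_ge0 ?lee_fin//; exact: sq0.
- by apply: measurable_funeM; exact: msq.
- exact: msq.
- by move=> z _; rewrite -EFinM lee_fin mulrA ler_wpM2r ?sqr_ge0// g12.
Qed.

End reversibility.

Theorem proposition3p3 (R : realType) (T : ptopologicalType)
    (polT : polish R T)
    (pi : probability (borel T) R)
    (gamma : R.-pker (borel T) ~> (borel T))
    (t : borel T * borel T -> R)
    (t_ratio : balancing_ratio pi gamma t)
    (g1 g2 : R -> R)
    (g1_bal : balancing_function g1) (g2_bal : balancing_function g2)
    (g1_nd : forall s u : R, 0 <= s -> s <= u -> g1 s <= g1 u)
    (g2_nd : forall s u : R, 0 <= s -> s <= u -> g2 s <= g2 u)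
    (omega : R) (omega_gt0 : 0 < omega)
    (g1_ge : forall s : R, 0 <= s -> omega * g2 s <= g1 s) :
  (omega%:E * spectral_gap pi (lb_generator gamma t g2)
     <= spectral_gap pi (lb_generator gamma t g1))%E.
Proof.
apply: le_ereal_inf_tmp => _ [f [mf bf Vf] <-].
apply: (@le_trans _ _ (omega%:E * (dirichlet_form pi (lb_generator gamma t g2) f
  / 'V_pi[f]))%E).
  rewrite lee_wpmul2l ?lee_fin ?(ltW omega_gt0)//.
  by apply: ereal_inf_lbound; exists f.
rewrite muleA lee_wpmul2r ?inve_ge0 ?(ltW Vf)//.
exact: (dirichlet_form_le _ _ _ t_ratio _ _ _ _ g1_bal g2_bal g1_nd g2_nd
  (ltW omega_gt0)).
Qed.
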